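(* (1) Let $(V,\langle\cdot,\cdot\rangle,J_-)$ be a $4$-dimensional Hermitian vector space of signature $(0,4)$. Then every element of $\Lambda_{0,+}^2\oplus\Lambda_-^2$ is realizable by a $4$-dimensional Hermitian Lie group; that is, for every $\Xi\in\Lambda_{0,+}^2\oplus\Lambda_-^2$ there exists a Lie bracket $[\cdot,\cdot]$ on $V$ such that $J_-$ is integrable and such that the alternating Ricci tensor $\rho_a$ of the Kähler--Weyl connection associated with the corresponding left-invariant Hermitian structure satisfies $\rho_a=\Xi$. (2) Let $(V,\langle\cdot,\cdot\rangle,J_+)$ be a $4$-dimensional para-Hermitian vector space of signature $(2,2)$. Then every element of $\Lambda_{0,-}^2\oplus\Lambda_+^2$ is realizable by a $4$-dimensional para-Hermitian Lie group; that is, for every $\Xi\in\Lambda_{0,-}^2\oplus\Lambda_+^2$ there exists a Lie bracket $[\cdot,\cdot]$ on $V$ such that $J_+$ is integrable and such that the alternating Ricci tensor $\rho_a$ of the Kähler--Weyl connection associated with the corresponding left-invariant para-Hermitian structure satisfies $\rho_a=\Xi$.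
   Context: All vector spaces and Lie groups are real. A Hermitian vector space of signature $(0,4)$ is a triple $(V,\langle\cdot,\cdot\rangle,J_-)$ where $V$ is a $4$-dimensional real vector space, $\langle\cdot,\cdot\rangle$ is a positive definite inner product, $J_-$ is an endomorphism with $J_-^2=-\operatorname{Id}$ and $\langle J_-x,J_-y\rangle=\langle x,y\rangle$. A para-Hermitian vector space of signature $(2,2)$ is a triple $(V,\langle\cdot,\cdot\rangle,J_+)$ where $V$ is a $4$-dimensional real vector space, $\langle\cdot,\cdot\rangle$ is a non-degenerate symmetric bilinear form of signature $(2,2)$, $J_+$ is an endomorphism with $J_+^2=\operatorname{Id}$, $\operatorname{Tr}(J_+)=0$ and $\langle J_+x,J_+y\rangle=-\langle x,y\rangle$. The Kähler form is $\Omega(x,y):=\langle x,J_\pm y\rangle$. Let $\Lambda^2=\Lambda^2V^*$ be the space of alternating bilinear forms on $V$, with the (possibly indefinite) inner product induced from $\langle\cdot,\cdot\rangle$, and let $J_\pm$ act on it by $(J_\pm\theta)(x,y)=\theta(J_\pm x,J_\pm y)$. In the complex setting put $$\Lambda_{0,+}^2=\{\theta\in\Lambda^2:J_-\theta=\theta,\ \theta\perp\Omega\},\qquad \Lambda_-^2=\{\theta\in\Lambda^2:J_-\theta=-\theta\}.$$ In the para-complex setting put $$\Lambda_{0,-}^2=\{\theta\in\Lambda^2:J_+\theta=-\theta,\ \theta\perp\Omega\},\qquad \Lambda_+^2=\{\theta\in\Lambda^2:J_+\theta=\theta\}.$$ Given a Lie bracket $[\cdot,\cdot]$ on $V$, one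 says that $J_-$ (resp. $J_+$) is integrable if the Nijenhuis tensor vanishes, i.e. for all $x,y\in V$, $$[x,y]+J_-[J_-x,y]+J_-[x,J_-y]-[J_-x,J_-y]=0$$ respectively $$[x,y]-J_+[J_+x,y]-J_+[x,J_+y]+[J_+x,J_+y]=0.$$ In that case let $G$ be the simply connected Lie group with Lie algebra $(V,[\cdot,\cdot])$; $\langle\cdot,\cdot\rangle$ and $J_\pm$ induce a left-invariant metric $g$ and a left-invariant integrable complex (resp. para-complex) structure, again denoted $J_\pm$, on $G$. Then $(G,g,J_\pm)$ is called a Hermitian (resp. para-Hermitian) Lie group. A Kähler--Weyl structure on a (para-)Hermitian manifold $(M,g,J_\pm)$ is a torsion-free connection $\nabla$ on $TM$ such that $\nabla g=-2\phi\otimes g$ for some smooth $1$-form $\phi$ on $M$, and $\nabla J_\pm=0$. It is a known fact that every $4$-dimensional (pseudo-)Hermitian or para-Hermitian manifold admits a unique such $\nabla$; this is the associated Kähler--Weyl connection. With $\mathcal{R}(x,y)z:=(\nabla_x\nabla_y-\nabla_y\nabla_x-\nabla_{[x,y]})z$, the Ricci tensor is $\rho(x,y):=\operatorname{Tr}\{z\mapsto\mathcal{R}(z,x)y\}$ and the alternating Ricci tensor is $\rho_a(x,y)=\frac12(\rho(x,y)-\rho(y,x))$. In the situation above $\rho_a$ is a left-invariant $2$-form on $G$ and is identified with its value at the identity, an element of $\Lambda^2V^*$. *)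

(* Defs.v *)
From mathcomp Require Import all_boot all_order all_algebra.
From mathcomp Require Import reals.

Set Implicit Arguments.
Unset Strict Implicit.
Unset Printing Implicit Defensive.

Import Order.TTheory GRing.Theory Num.Theory.
Local Open Scope ring_scope.

Section Structures.
Variables (R : realType) (V : vectType R).

Definition sym_form (g : {biscalar V}) : Prop := forall x y, g x y = g y x.

Definition pos_def (g : {biscalar V}) : Prop :=
  forall x, x != 0 -> 0 < g x x.

Definition nondegenerate_form (g : {biscalar V}) : Prop :=
  forall x, (forall y, g x y = 0) -> x = 0.

(* As in signature (p, q) = (number of -1's, number of +1's), so that (0, 4)
   is positive definite in dimension 4. *)
Definition has_signature (p q : nat) (g : {biscalar V}) : Prop :=
  exists2 b : (p + q).-tuple V, basis_of {:V} b &
    forall i j : 'I_(p + q),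
      g b`_i b`_j = if i == j then (if (i < p)%N then -1 else 1) else 0.

(* Trace of a linear map, as the sum of its diagonal coefficients in a basis
   (the value does not depend on the basis). *)
Definition trace (f : V -> V) : R :=
  \sum_i coord (vbasis {:V}) i (f (vbasis {:V})`_i).

Definition hermitian_space (g : {biscalar V}) (J : 'End(V)) : Prop :=
  [/\ \dim {:V} = 4%N,
      sym_form g /\ pos_def g,
      forall x, J (J x) = - x
    & forall x y, g (J x) (J y) = g x y].

Definition para_hermitian_space (g : {biscalar V}) (J : 'End(V)) : Prop :=
  [/\ \dim {:V} = 4%N,
      [/\ sym_form g, nondegenerate_form g & has_signature 2 2 g],
      forall x, J (J x) = x,
      trace J = 0
    & forall x y, g (J x) (J y) = - g x y].

Definition kahler_form (g : {biscalar V}) (J : 'End(V)) : V -> V -> R :=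
  fun x y => g x (J y).

Definition form_mx (f : V -> V -> R) : 'M[R]_(\dim {:V}) :=
  \matrix_(i, j) f (vbasis {:V})`_i (vbasis {:V})`_j.

(* The inner product induced by g on 2-forms:
   (1/2) g^{ik} g^{jl} theta_{ij} eta_{kl}. With this normalization the
   e^i /\ e^j, i < j, are orthonormal up to sign for an orthonormal (e_i). *)
Definition form2_dot (g : {biscalar V}) (theta eta : V -> V -> R) : R :=
  2^-1 * \tr (invmx (form_mx g) *m form_mx theta
              *m invmx (form_mx g) *m (form_mx eta)^T).

Definition alternating (theta : {biscalar V}) : Prop :=
  forall x, theta x x = 0.

(* Primitive 2-forms with J theta = s theta: for s = 1 and J complex this is
   Lambda^2_{0,+}, for s = -1 and J para-complex this is Lambda^2_{0,-}. *)
Definition Lambda2_0 (s : R) (g : {biscalar V}) (J : 'End(V))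
    (theta : {biscalar V}) : Prop :=
  [/\ alternating theta,
      forall x y, theta (J x) (J y) = s * theta x y
    & form2_dot g theta (kahler_form g J) = 0].

Definition Lambda2 (s : R) (J : 'End(V)) (theta : {biscalar V}) : Prop :=
  alternating theta /\ forall x y, theta (J x) (J y) = s * theta x y.

(* Xi lies in the sum Lambda^2_{0,s} + Lambda^2_{-s}, which is direct since J
   acts by s on the first summand and by -s on the second. *)
Definition Lambda2_sum (s : R) (g : {biscalar V}) (J : 'End(V))
    (Xi : {biscalar V}) : Prop :=
  exists theta eta : {biscalar V},
    [/\ Lambda2_0 s g J theta, Lambda2 (- s) J eta
      & forall x y, Xi x y = theta x y + eta x y].

Definition lie_bracket (br : {bilinear V -> V -> V}) : Prop :=
  (forall x, br x x = 0) /\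
  (forall x y z, br x (br y z) + br y (br z x) + br z (br x y) = 0).

Definition complex_integrable (br : {bilinear V -> V -> V}) (J : 'End(V)) :=
  forall x y, br x y + J (br (J x) y) + J (br x (J y)) - br (J x) (J y) = 0.

Definition para_complex_integrable (br : {bilinear V -> V -> V})
    (J : 'End(V)) :=
  forall x y, br x y - J (br (J x) y) - J (br x (J y)) + br (J x) (J y) = 0.

(* Left-invariant tensors and connections on the simply connected Lie group
   with Lie algebra (V, br) are given by their values on left-invariant vector
   fields, i.e. on V; a left-invariant connection is a bilinear map
   D x y = nabla_x y. The Kaehler-Weyl connection of a left-invariant structure
   is left-invariant because it is unique. *)

Definition torsion_free (br D : {bilinear V -> V -> V}) : Prop :=
  forall x y, D x y - D y x = br x y.

(* (nabla_z g)(x, y) = z (g(x, y)) - g(nabla_z x, y) - g(x, nabla_z y), whose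
   first term vanishes because g(x, y) is constant for left-invariant x, y. *)
Definition cov_deriv_metric (D : {bilinear V -> V -> V}) (g : {biscalar V})
    (z x y : V) : R :=
  - g (D z x) y - g x (D z y).

Definition kahler_weyl (br : {bilinear V -> V -> V}) (g : {biscalar V})
    (J : 'End(V)) (D : {bilinear V -> V -> V}) : Prop :=
  [/\ torsion_free br D,
      exists phi : {scalar V},
        forall z x y, cov_deriv_metric D g z x y = - 2 * (phi z * g x y)
    & forall x y, D x (J y) - J (D x y) = 0].

Definition associated_kahler_weyl (br : {bilinear V -> V -> V})
    (g : {biscalar V}) (J : 'End(V)) (D : {bilinear V -> V -> V}) : Prop :=
  kahler_weyl br g J D /\
  forall D' : {bilinear V -> V -> V},
    kahler_weyl br g J D' -> forall x y, D' x y = D x y.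

Definition curvature (br D : {bilinear V -> V -> V}) (x y z : V) : V :=
  D x (D y z) - D y (D x z) - D (br x y) z.

Definition ricci (br D : {bilinear V -> V -> V}) (x y : V) : R :=
  trace (fun z => curvature br D z x y).

Definition alt_ricci (br D : {bilinear V -> V -> V}) (x y : V) : R :=
  2^-1 * (ricci br D x y - ricci br D y x).

Definition hermitian_realizable (g : {biscalar V}) (J : 'End(V))
    (Xi : {biscalar V}) : Prop :=
  exists br : {bilinear V -> V -> V},
    [/\ lie_bracket br, complex_integrable br J
      & exists2 D : {bilinear V -> V -> V},
          associated_kahler_weyl br g J D
        & forall x y, alt_ricci br D x y = Xi x y].

Definition para_hermitian_realizable (g : {biscalar V}) (J : 'End(V))
    (Xi : {biscalar V}) : Prop :=
  exists br : {bilinear V -> V -> V},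
    [/\ lie_bracket br, para_complex_integrable br J
      & exists2 D : {bilinear V -> V -> V},
          associated_kahler_weyl br g J D
        & forall x y, alt_ricci br D x y = Xi x y].

End Structures.

(* Main.v *)
(* A torsion-free connection D commuting with J and conformally g-skew is
   automatically the Kaehler-Weyl connection of its bracket [u, v] = D_u v - D_v u,
   and J is then integrable.  By the first Bianchi identity,
   rho_a(u, v) = tr D_[u, v] / 2 = 2 phi([u, v]) for the Weyl form phi.

   Choose a g-orthogonal basis x, J x, y, J y with Xi(x, J x) = Xi(y, J y) = 0,
   which is possible because u |-> Xi(u, J u) is a traceless quadratic form.
   Let y and J y span an abelian ideal on which x and J x act by the commuting
   endomorphisms x1 + x2 J and y1 + y2 J, and put [x, J x] = y.  Its Weyl form
   satisfies phi(y) = 0 and phi(J y) = 1/2, so that the four remaining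
   components of 2 phi([u, v]) are exactly x1, x2, y1, y2. *)
Require Import Defs.
From HB Require Import structures.
From mathcomp Require Import all_boot all_order all_algebra.
From mathcomp Require Import reals ring lra.

Set Implicit Arguments.
Unset Strict Implicit.
Unset Printing Implicit Defensive.

Import Order.TTheory GRing.Theory Num.Theory.
Local Open Scope ring_scope.

Lemma alternating_skew (R : realType) (V : vectType R) (theta : {biscalar V}) :
  alternating theta -> forall u v, theta u v = - theta v u.
Proof.
move=> alt u v; apply/eqP; rewrite -addr_eq0; have := alt (u + v).
by rewrite linearDl !linearDr !alt add0r addr0 => ->.
Qed.

(** * Traces and the alternating Ricci tensor *)

Section Trace.
Variables (R : realType) (V : vectType R).

Lemma coord_vbasis_inj (u v : V) :
  (forall i, coord (vbasis {:V}) i u = coord (vbasis {:V}) i v) -> u = v.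
Proof.
move=> uv; rewrite [u](coord_vbasis (memvf _)) [v](coord_vbasis (memvf _)).
by apply: eq_bigr => i _; rewrite uv.
Qed.

(** The definition of [trace] is tied to [vbasis]; this moves it to an adapted frame, where the
    connection is explicit. Both sides are one double sum, summed in either order. *)
Lemma trace_dual_basis n (b : 'I_n -> V) (c : 'I_n -> {scalar V})
    (f : {linear V -> V}) :
  (forall v, v = \sum_i c i v *: b i) -> trace f = \sum_i c i (f (b i)).
Proof.
move=> bc; rewrite /trace.
under eq_bigr => i _.
  rewrite {1}[X in f X]bc linear_sum linear_sum.
  under eq_bigr => j _ do rewrite linearZ linearZ /= mulrC.
  over.
rewrite exchange_big /=; apply: eq_bigr => j _.
rewrite [f (b j) in RHS](coord_vbasis (memvf _)) linear_sum.
by apply: eq_bigr => i _; rewrite linearZ.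
Qed.

Lemma traceC (f h : {linear V -> V}) : trace (f \o h) = trace (h \o f).
Proof.
have E (k l : {linear V -> V}) : trace (k \o l) =
    \sum_(i < \dim {:V}) \sum_(j < \dim {:V})
      coord (vbasis {:V}) j (l (vbasis {:V})`_i) *
      coord (vbasis {:V}) i (k (vbasis {:V})`_j).
  apply: eq_bigr => i _ /=.
  rewrite {1}[l _](coord_vbasis (memvf _)) !linear_sum.
  by apply: eq_bigr => j _; rewrite !linearZ.
rewrite !E exchange_big; apply: eq_bigr => i _; apply: eq_bigr => j _.
by rewrite mulrC.
Qed.

Lemma traceD (f h : V -> V) : trace (fun z => f z + h z) = trace f + trace h.
Proof.
by rewrite /trace -big_split; apply: eq_bigr => i _; rewrite linearD.
Qed.

Lemma traceN (f : V -> V) : trace (fun z => - f z) = - trace f.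
Proof.
by rewrite /trace -sumrN; apply: eq_bigr => i _; rewrite linearN.
Qed.

Lemma eq_trace (f h : V -> V) : f =1 h -> trace f = trace h.
Proof. by move=> fh; apply: eq_bigr => i _; rewrite fh. Qed.

(* By the first Bianchi identity the two Ricci traces differ by the trace of
   the curvature endomorphism, in which the commutator part is traceless. *)
Lemma alt_ricci_trace (br D : {bilinear V -> V -> V}) :
  lie_bracket br -> torsion_free br D ->
  forall x y, alt_ricci br D x y = 2^-1 * trace (D (br x y)).
Proof.
move=> [br0 jac] tf x y; rewrite /alt_ricci; congr (_ * _).
have brC u v : br u v = - br v u.
  by rewrite -!tf opprB.
have bianchi u v w : curvature br D u v w + curvature br D v w u
    + curvature br D w u v = 0.
  have K a b c : D a (D b c) - D a (D c b) = D a (br b c).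
    by rewrite -linearBr tf.
  (* Vanishing torsion turns the cyclic sum of curvatures into the Jacobi sum. *)
  transitivity (br u (br v w) + br v (br w u) + br w (br u v)); last exact: jac.
  rewrite -[br u (br v w)]tf -[br v (br w u)]tf -[br w (br u v)]tf -!K.
  apply: coord_vbasis_inj => i; rewrite /curvature !(linearD, linearN) /=; ring.
rewrite /ricci -traceN -traceD.
have E z : curvature br D z x y - curvature br D z y x =
           D (br x y) z + (D y (D x z) - D x (D y z)).
  move: (bianchi z x y); rewrite /curvature [br y z]brC linearNl => H.
  apply: coord_vbasis_inj => i; move/(congr1 (coord (vbasis {:V}) i)): H.
  rewrite !(linearD, linearN, linear0) /= => H.
  rewrite -[RHS]addr0 -[in RHS]H; ring.
rewrite (eq_trace E) traceD traceD traceN.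
have := traceC (D x) (D y); rewrite /comp /= => ->.
by rewrite subrr addr0.
Qed.

Lemma bilinear_of (f : V -> V -> V) :
  (forall w, linear (f ^~ w)) -> (forall u, linear (f u)) ->
  exists F : {bilinear V -> V -> V}, forall u v, F u v = f u v.
Proof.
move=> l1 l2; pose m := bilinear_isBilinear.Build R V V V *:%R *:%R f (l1, l2).
by exists (HB.pack f m : {bilinear V -> V -> V}).
Qed.
End Trace.

(* The parameter [s] treats both cases at once: [s = 1] is the Hermitian case
   and [s = -1] the para-Hermitian one. *)
Definition compatible (R : realType) (V : vectType R) (s : R)
    (g : {biscalar V}) (J : 'End(V)) : Prop :=
  [/\ s * s = 1, sym_form g, forall u, J (J u) = - s *: u
    & forall u v, g (J u) (J v) = s * g u v].

(* [x, J x, y, J y] is then a [g]-orthogonal basis, with [g]-norms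
   [1, s, 1, s]. *)
Definition adapted (R : realType) (V : vectType R)
    (g : {biscalar V}) (J : 'End(V)) (x y : V) : Prop :=
  [/\ g x x = 1, g y y = 1, g x y = 0 & g x (J y) = 0].

(** * Adapted frames as orthogonal bases *)

Section Adapted.
Variables (R : realType) (V : vectType R) (s : R) (g : {biscalar V}).
Variable J : 'End(V).
Hypotheses (dimV : \dim {:V} = 4%N) (comp : compatible s g J).

Lemma compatible_skew u v : g (J u) v = - g u (J v).
Proof.
case: comp => ss _ JJ gJ.
have := gJ u (J v); rewrite JJ linearZr_LR => h.
transitivity (- s * (- s * g (J u) v)); last by rewrite h; ring: ss.
ring: ss.
Qed.

Lemma compatible_J0 u : g u (J u) = 0.
Proof.
have := compatible_skew u u; case: comp => _ gC _ _; rewrite gC; lra.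
Qed.

Section Frame.
Variables x y : V.
Hypothesis xy : adapted g J x y.

Lemma adapted_table :
  [/\ (g x x = 1) * (g x (J x) = 0) * (g x y = 0) * (g x (J y) = 0),
      (g (J x) x = 0) * (g (J x) (J x) = s) * (g (J x) y = 0) *
      (g (J x) (J y) = 0),
      (g y x = 0) * (g y (J x) = 0) * (g y y = 1) * (g y (J y) = 0)
    & (g (J y) x = 0) * (g (J y) (J x) = 0) * (g (J y) y = 0) *
      (g (J y) (J y) = s)]%type.
Proof.
case: comp => ss gC _ gJ; case: xy => gxx gyy gxy gxJy.
have gyJx : g y (J x) = 0 by rewrite gC compatible_skew gxJy oppr0.
do !split; rewrite ?compatible_J0 ?gJ ?gxx ?gyy ?gxy ?mulr1 ?mulr0 //.
- by rewrite gC compatible_J0.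
- by rewrite gC.
- by rewrite gC.
- by rewrite gC.
- by rewrite gC gxy mulr0.
- by rewrite gC compatible_J0.
Qed.

Definition frame_vec (a b c d : R) : V :=
  a *: x + b *: J x + c *: y + d *: J y.

Lemma frame_expand u : u = frame_vec (g x u) (s * g (J x) u)
                             (g y u) (s * g (J y) u).
Proof.
case: comp => ss gC _ gJ; have [tx tJx ty tJy] := adapted_table.
pose X := [tuple x; J x; y; J y].
have freeX : free X.
  apply/freeP => k; rewrite !big_ord_recl big_ord0 /= addr0 => k0.
  have P w : k ord0 * g w x + (k (lift ord0 ord0) * g w (J x) +
      (k (lift ord0 (lift ord0 ord0)) * g w y +
       k (lift ord0 (lift ord0 (lift ord0 ord0))) * g w (J y))) = 0.
    by rewrite -!linearZr_LR -!linearDr k0 linear0r.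
  have s0 : s != 0.
    by apply: contra_eq_neq ss => ->; rewrite mulr0 eq_sym oner_eq0.
  have := P x; rewrite !tx !mulr1 !mulr0 !addr0 => k_0.
  have := P (J x); rewrite !tJx !mulr0 !addr0 !add0r => /eqP.
  rewrite mulf_eq0 (negPf s0) orbF => /eqP k_1.
  have := P y; rewrite !ty !mulr1 !mulr0 !addr0 !add0r => k_2.
  have := P (J y); rewrite !tJy !mulr0 !add0r => /eqP.
  rewrite mulf_eq0 (negPf s0) orbF => /eqP k_3.
  by case=> [[|[|[|[|//]]]] i];
    [move: k_0 | move: k_1 | move: k_2 | move: k_3] => <-;
    congr (k _); apply: val_inj.
have bX : basis_of {:V} X by rewrite basisEfree freeX subvf size_tuple dimV.
have := coord_basis bX (memvf u); rewrite !big_ord_recl big_ord0 /= addr0.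
set a := coord _ _ _; set b := coord _ _ _; set c := coord _ _ _.
set d := coord _ _ _ => ->; rewrite /frame_vec !linearDr !linearZr_LR.
rewrite !(tx, tJx, ty, tJy) !addrA; congr (_ *: _ + _ *: _ + _ *: _ + _ *: _).
- ring.
- ring: ss.
- ring.
- ring: ss.
Qed.

Lemma frame_nondegenerate u : (forall w, g w u = 0) -> u = 0.
Proof.
by move=> gu0; rewrite (frame_expand u) /frame_vec !gu0 !mulr0 !scale0r !addr0.
Qed.

End Frame.
End Adapted.

(** With [B] the coordinates of [b] and [E] the diagonal matrix of [eps], the hypothesis says that
    [B^T *m E *m B] inverts the Gram matrix of [g]. Cyclicity of the trace then moves the factors
    [B] onto the two forms. *)
Lemma form2_dot_frame (R : realType) (V : vectType R) (g theta : {biscalar V})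
    (h : {linear V -> V}) n (b : 'I_n -> V) (eps : 'I_n -> R) :
  (forall v, v = \sum_i (eps i * g (b i) v) *: b i) ->
  form2_dot g theta (fun u v => g u (h v)) =
  2^-1 * \sum_k \sum_l eps k * theta (b k) (b l) * (eps l * g (b k) (h (b l))).
Proof.
move=> frame; rewrite /form2_dot; congr (_ * _).
pose e := vbasis {:V}.
pose B := \matrix_(k < n, i < \dim {:V}) coord e i (b k).
pose E := diag_mx (\row_k eps k).
have conjB (f : {biscalar V}) (k : {linear V -> V}) :
    B *m form_mx (fun u v => f u (k v)) *m B^T =
    \matrix_(i, j) f (b i) (k (b j)).
  apply/matrixP=> i j; rewrite !mxE.
  rewrite [b j in RHS](coord_vbasis (memvf _)) !linear_sum.
  apply: eq_bigr => l _; rewrite !linearZ !mxE mulrC /=.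
  congr (_ * _); rewrite [b i in RHS](coord_vbasis (memvf _)) linear_sumlz.
  by apply: eq_bigr => m _; rewrite linearZl_LR !mxE.
have KG : (B^T *m E *m B) *m form_mx g = 1%:M.
  apply/matrixP=> i j; rewrite -mulmxA !mxE.
  rewrite eq_sym -(coord_free j i (basis_free (vbasisP _))).
  rewrite [e`_j in RHS]frame linear_sum; apply: eq_bigr => k _.
  rewrite mul_mx_diag linearZ !mxE /=.
  have -> : \sum_l B k l * form_mx g l j = g (b k) e`_j.
    rewrite [b k in RHS](coord_vbasis (memvf _)) linear_sumlz.
    by apply: eq_bigr => l _; rewrite linearZl_LR !mxE.
  ring.
have G_unit : form_mx g \in unitmx by case: (mulmx1_unit KG).
have -> : invmx (form_mx g) = B^T *m E *m B.
  by rewrite -[LHS]mul1mx -KG mulmxK.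
rewrite -!mulmxA mxtrace_mulC -!mulmxA.
have -> : B *m ((form_mx (fun u v => g u (h v)))^T *m B^T) =
  (\matrix_(i, j) g (b i) (h (b j)))^T.
  by rewrite -conjB !trmx_mul trmxK mulmxA.
set W := (\matrix_(i, j) g (b i) (h (b j)))^T.
have -> : E *m (B *m (form_mx theta *m (B^T *m (E *m W)))) =
    (E *m (B *m form_mx theta *m B^T)) *m (E *m W) by rewrite !mulmxA.
rewrite (conjB theta idfun) /mxtrace; apply: eq_bigr => k _.
by rewrite mxE; apply: eq_bigr => l _; rewrite !mul_diag_mx !mxE.
Qed.

(** * Choice of a frame isotropic for a primitive form *)

Section Choice.
Variables (R : realType) (V : vectType R) (s : R) (g : {biscalar V}).
Variable J : 'End(V).
Hypotheses (dimV : \dim {:V} = 4%N) (comp : compatible s g J).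

(** In an adapted frame the Kaehler form pairs only [x] with [J x] and [y] with [J y], so its
    product with [theta] is minus this sum. *)
Lemma primitive_trace x y (theta : {biscalar V}) :
  adapted g J x y -> Lambda2_0 s g J theta ->
  theta x (J x) + theta y (J y) = 0.
Proof.
move=> xy [alt tJ]; rewrite /kahler_form.
have [tx tJx ty tJy] := adapted_table comp xy.
have thC := alternating_skew alt.
pose b (i : 'I_4) := [:: x; J x; y; J y]`_i.
pose eps (i : 'I_4) : R := [:: 1; s; 1; s]`_i.
rewrite (@form2_dot_frame _ _ _ _ J _ b eps); last first.
  move=> v; rewrite {1}(frame_expand dimV comp xy v) /frame_vec.
  by rewrite !big_ord_recl big_ord0 /b /eps /= !mul1r addr0 !addrA.
case: comp => ss _ JJ _.
rewrite !big_ord_recl !big_ord0 /b /eps /= !JJ !linearZr_LR.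
rewrite !(tx, tJx, ty, tJy) (thC (J x) x) (thC (J y) y) => h.
by rewrite -[LHS]mul1r -ss -[RHS]oppr0 -[in RHS]h; field.
Qed.

Lemma adapted_normalize u v :
  0 < g u u -> 0 < g v v -> g u v = 0 -> g u (J v) = 0 ->
  adapted g J ((Num.sqrt (g u u))^-1 *: u) ((Num.sqrt (g v v))^-1 *: v).
Proof.
have nz w : 0 < g w w ->
    g ((Num.sqrt (g w w))^-1 *: w) ((Num.sqrt (g w w))^-1 *: w) = 1.
  move=> w0; rewrite linearZl_LR linearZr_LR mulrA -expr2 exprVn.
  by rewrite sqr_sqrtr ?ltW // mulVf // gt_eqF.
move=> u0 v0 uv uJv; split; rewrite ?nz //.
  by rewrite linearZl_LR linearZr_LR uv !mulr0.
by rewrite [J _]linearZ linearZl_LR linearZr_LR uJv !mulr0.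
Qed.

(* [theta z (J z)] is a traceless quadratic form in [z], so it has a zero on
   the plane spanned by [x] and [y]. *)
Lemma adapted_isotropic x y (theta : {biscalar V}) :
  adapted g J x y -> Lambda2_0 s g J theta ->
  exists x' y', [/\ adapted g J x' y', theta x' (J x') = 0
                  & theta y' (J y') = 0].
Proof.
move=> xy th.
(* Tracelessness carries a zero at [x'] over to [y']. *)
suff [x' [y' [xy' t0]]] : exists x' y', adapted g J x' y' /\ theta x' (J x') = 0.
  exists x', y'; split=> //.
  by have := primitive_trace xy' th; rewrite t0 add0r.
have tr0 := primitive_trace xy th.
have [a0|a_neq0] := eqVneq (theta x (J x)) 0; first by exists x, y.
have [tx tJx ty tJy] := adapted_table comp xy.
have [ss _ JJ _] := comp; have [alt tJ _] := th.
pose a := theta x (J x); pose b := theta x (J y).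
(* Invariance of [theta] under [J] makes the polarized quadratic form symmetric. *)
have tyx : theta y (J x) = b.
  have := tJ x (J y).
  rewrite JJ linearZr_LR (alternating_skew alt (J x)) -/b => h.
  transitivity (s * (- s * - theta y (J x))); first by ring: ss.
  rewrite h; ring: ss.
(* At [x + r *: y] the quadratic form is [a + 2 * r * b - r ^+ 2 * a]; [r] is a root, real because
   the discriminant is a sum of squares. *)
pose r := (b + Num.sqrt (b ^+ 2 + a ^+ 2)) / a.
have rP : a + 2 * r * b - r ^+ 2 * a = 0.
  have q2 : Num.sqrt (b ^+ 2 + a ^+ 2) ^+ 2 = b ^+ 2 + a ^+ 2.
    by rewrite sqr_sqrtr // addr_ge0 // sqr_ge0.
  rewrite /r; move: q2; set q := Num.sqrt _ => q2.
  transitivity ((a ^+ 2 + b ^+ 2 - q ^+ 2) / a); first by field.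
  by rewrite q2; ring.
have r2 : 0 < 1 + r ^+ 2 by rewrite ltr_wpDr // sqr_ge0.
have E : (g (x + r *: y) (x + r *: y) = 1 + r ^+ 2) *
    (g (y - r *: x) (y - r *: x) = 1 + r ^+ 2).
  split; rewrite !(linearDl, linearDr, linearNl, linearNr, linearZl_LR,
    linearZr_LR) !(tx, ty) /=; ring.
(* The new pair is a rotation of [x], [y] in their plane, so it is again adapted. *)
exists ((Num.sqrt (1 + r ^+ 2))^-1 *: (x + r *: y)),
  ((Num.sqrt (1 + r ^+ 2))^-1 *: (y - r *: x)); split.
  rewrite -{1}E.1 -E.2; apply: adapted_normalize; rewrite ?E //.
    rewrite !(linearDl, linearDr, linearNl, linearNr, linearZl_LR,
      linearZr_LR) !(tx, ty) /=; ring.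
  rewrite [J _]linearB /= [J (r *: x)]linearZ /= !(linearDl, linearDr,
    linearNl, linearNr, linearZl_LR, linearZr_LR) !(tx, ty) /=; ring.
rewrite [J _]linearZ linearZl_LR linearZr_LR /= [J _]linearD /=.
rewrite [J (r *: y)]linearZ /=.
rewrite !(linearDl, linearDr, linearZl_LR, linearZr_LR) tyx -/a -/b.
have -> : theta y (J y) = - a by apply/eqP; rewrite -addr_eq0 addrC tr0.
rewrite (_ : a + r * b + (r * b + r * (r * - a)) = 0) ?mulr0 //.
by rewrite -[RHS]rP; ring.
Qed.
End Choice.

(** * Existence of adapted frames in both signatures *)

Lemma hermitian_adapted (R : realType) (V : vectType R) (g : {biscalar V})
    (J : 'End(V)) :
  hermitian_space g J -> compatible 1 g J /\ exists x y, adapted g J x y.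
Proof.
move=> [dimV [gC gpos] JJ gJ].
have comp : compatible 1 g J.
  by split=> //; [rewrite mulr1 | move=> u; rewrite JJ scaleN1r
                 | move=> u v; rewrite gJ mul1r].
split=> //.
have ex (X : seq V) : (size X < 4)%N -> exists v, v \notin <<X>>%VS.
  move=> sX; have /subvPn[v _ vX] : ~~ ({:V} <= <<X>>)%VS.
    apply/negP => /dimvS; rewrite dimV leqNgt.
    by rewrite (leq_ltn_trans (dim_span X)).
  by exists v.
have [u u0] := ex [::] isT.
have {}u0 : u != 0 by apply: contraNneq u0 => ->; rewrite mem0v.
have uu := gpos _ u0.
have [w w0] := ex [:: u; J u] isT.
have uJu := compatible_J0 comp u.
have Juu : g (J u) u = 0 by rewrite gC.
(* Orthogonal projection away from [u] and [J u], which have the same norm; it is nonzero because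
   [w] lies outside their span. *)
pose v := w - (g u w / g u u) *: u - (g (J u) w / g u u) *: J u.
have v0 : v != 0.
  apply: contraNneq w0 => /eqP; rewrite !subr_eq add0r => /eqP ->.
  by rewrite memvD ?memvZ ?memv_span ?inE ?eqxx ?orbT.
have uv : g u v = 0.
  rewrite /v !(linearBr, linearZr_LR) uJu mulr0 subr0 divfK ?gt_eqF //.
  exact: subrr.
have Juv : g (J u) v = 0.
  rewrite /v !(linearBr, linearZr_LR) Juu mulr0 subr0 gJ divfK ?gt_eqF //.
  exact: subrr.
exists ((Num.sqrt (g u u))^-1 *: u), ((Num.sqrt (g v v))^-1 *: v).
apply: adapted_normalize => //; first exact: gpos.
by apply/eqP; rewrite -oppr_eq0 -(compatible_skew comp) Juv.
Qed.

Lemma para_hermitian_adapted (R : realType) (V : vectType R) (g : {biscalar V})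
    (J : 'End(V)) :
  para_hermitian_space g J -> compatible (-1) g J /\ exists x y, adapted g J x y.
Proof.
move=> [dimV [gC _ [e _ eg]] JJ _ gJ].
have comp : compatible (-1) g J.
  by split=> //; [rewrite mulrNN mulr1 | move=> u; rewrite JJ opprK scale1r
                 | move=> u v; rewrite gJ mulN1r].
split=> //.
(* In [has_signature 2 2] the negative vectors come first, so indices 2 and 3 are the positive
   ones. *)
pose i2 : 'I_4 := @Ordinal 4 2 isT; pose i3 : 'I_4 := @Ordinal 4 3 isT.
have /= e22 := eg i2 i2; have /= e33 := eg i3 i3; have /= e23 := eg i2 i3.
set u := e`_2 in e22 e23; set w := e`_3 in e33 e23.
have uJu := compatible_J0 comp u.
have Juu : g (J u) u = 0 by rewrite gC.
(* As [J u] has norm -1, adding [k *: J u] makes the vector orthogonal to [J u] and can only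
   increase its norm, which stays positive. *)
pose k := g (J u) w; pose v := w + k *: J u.
have uv : g u v = 0 by rewrite linearDr linearZr_LR e23 uJu mulr0 addr0.
have Juv : g (J u) v = 0 by rewrite linearDr linearZr_LR gJ e22 mulrN1 subrr.
have vv : g v v = 1 + k ^+ 2.
  rewrite {1}/v linearDl linearZl_LR Juv mulr0 addr0 linearDr linearZr_LR e33.
  by rewrite (gC w).
exists ((Num.sqrt (g u u))^-1 *: u), ((Num.sqrt (g v v))^-1 *: v).
apply: adapted_normalize => //.
- by rewrite e22.
- by rewrite vv ltr_wpDr // sqr_ge0.
- by apply/eqP; rewrite -oppr_eq0 -(compatible_skew comp) Juv.
Qed.

(** * Uniqueness of the Kaehler-Weyl connection *)

Section Realization.
Variables (R : realType) (V : vectType R) (s : R) (g : {biscalar V}).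
Variables (J : 'End(V)) (x y : V).
Hypotheses (dimV : \dim {:V} = 4%N) (comp : compatible s g J).
Hypothesis xy : adapted g J x y.

(* Two Weyl connections with the same torsion differ by
   [psi(u) v + psi(v) u - g(u, v) psi^#] for a 1-form [psi]; commuting with [J]
   forces [psi = 0] as soon as the dimension exceeds 2. *)
Lemma kahler_weyl_unique (br D D' : {bilinear V -> V -> V}) :
  kahler_weyl br g J D -> kahler_weyl br g J D' ->
  forall u v, D' u v = D u v.
Proof.
move=> [tf [phi Dg] DJ] [tf' [phi' Dg'] DJ'].
have [ss gC JJ gJ] := comp.
have [tx tJx ty tJy] := adapted_table comp xy.
pose S u v := D' u v - D u v; pose psi w := phi' w - phi w.
have SC u v : S u v = S v u.
  have -> : S u v = br u v + D' v u - (br u v + D v u).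
    by rewrite -{1}tf' -tf !subrK.
  by rewrite opprD addrACA subrr add0r.
have Sg w u v : g (S w u) v + g u (S w v) = 2 * (psi w * g u v).
  have := Dg w u v; have := Dg' w u v; rewrite /cov_deriv_metric /S /psi.
  rewrite linearBl linearBr => h1 h2; lra.
have SJ u v : S u (J v) = J (S u v).
  have /eqP := DJ u v; rewrite subr_eq0 => /eqP h.
  have /eqP := DJ' u v; rewrite subr_eq0 => /eqP h'.
  by rewrite /S h h' linearB.
(* The Koszul trick: a signed sum of three instances of [Sg], with [S] symmetric, isolates one
   term. *)
have koszul u v w :
    g (S u v) w = psi u * g v w + psi v * g u w - psi w * g u v.
  have h1 := Sg u v w; have h2 := Sg v u w; have h3 := Sg w u v.
  move: h1 h2 h3; rewrite (SC v u) (SC w u) (SC w v) (gC v (S u w)).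
  rewrite (gC u (S v w)); lra.
(* [koszul] evaluated on both sides of [S u (J v) = J (S u v)]. *)
have psiJ u v w : psi (J v) * g u w - psi w * g u (J v) + psi v * g u (J w)
    - psi (J w) * g u v = 0.
  have := koszul u (J v) w; rewrite SJ (compatible_skew comp).
  rewrite (compatible_skew comp) koszul; lra.
have psi0 w : psi w = 0.
  (* Testing [psiJ] against [y] leaves only [psi (J l)] for [l] in the [J]-plane of [x]; [L2]
     exchanges the two planes. This is where dimension above 2 enters. *)
  have L1 (l : V) : g y l = 0 -> g y (J l) = 0 -> psi (J l) = 0.
    move=> yl yJl; have := psiJ y l y.
    by rewrite yl yJl !ty; lra.
  have L2 (l : V) : g x l = 0 -> g x (J l) = 0 -> psi (J l) = 0.
    move=> xl xJl; have := psiJ x l x.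
    by rewrite xl xJl !tx; lra.
  have psiN l : psi (- s *: l) = - s * psi l.
    by rewrite /psi !linearZ /= -mulrBr.
  have p1 : psi (J x) = 0 by apply: L1; rewrite ty.
  have p3 : psi (J y) = 0 by apply: L2; rewrite tx.
  have p0 : - s * psi x = 0.
    by rewrite -psiN -JJ; apply: L1; rewrite ?JJ ?linearZr_LR ty ?mulr0.
  have p2 : - s * psi y = 0.
    by rewrite -psiN -JJ; apply: L2; rewrite ?JJ ?linearZr_LR tx ?mulr0.
  have {}p0 : psi x = 0 by transitivity (- s * (- s * psi x));
    [ring: ss | rewrite p0 mulr0].
  have {}p2 : psi y = 0 by transitivity (- s * (- s * psi y));
    [ring: ss | rewrite p2 mulr0].
  move: p0 p1 p2 p3; rewrite (frame_expand dimV comp xy w) /frame_vec /psi.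
  rewrite !linearD !linearZ /= => p0 p1 p2 p3.
  rewrite (subr0_eq p0) (subr0_eq p1) (subr0_eq p2) (subr0_eq p3); ring.
move=> u v; apply/eqP; rewrite -subr_eq0 -/(S u v); apply/eqP.
apply: (frame_nondegenerate dimV comp xy) => w.
by rewrite gC koszul !psi0 !mul0r addr0 subr0.
Qed.

Local Notation vec := (frame_vec J x y).
Local Notation c0 u := (g x u).
Local Notation c1 u := (s * g (J x) u).
Local Notation c2 u := (g y u).
Local Notation c3 u := (s * g (J y) u).

Lemma frame_coordE a b c d :
  (c0 (vec a b c d) = a) * (c1 (vec a b c d) = b) *
  (c2 (vec a b c d) = c) * (c3 (vec a b c d) = d).
Proof.
have [ss _ _ _] := comp.
have [tx tJx ty tJy] := adapted_table comp xy.
rewrite /frame_vec !linearDr !linearZr_LR !(tx, tJx, ty, tJy).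
by do !split; ring: ss.
Qed.

Lemma frame_J a b c d : J (vec a b c d) = vec (- s * b) a (- s * d) c.
Proof.
have [_ _ JJ _] := comp; rewrite /frame_vec !linearD !linearZ /= !JJ !scalerA.
rewrite ![b * _]mulrC ![d * _]mulrC -!addrA addrCA; congr (_ + (_ + _)).
by rewrite addrC.
Qed.

Lemma frame_lin a b c d a' b' c' d' k :
  k *: vec a b c d + vec a' b' c' d' =
  vec (k * a + a') (k * b + b') (k * c + c') (k * d + d').
Proof.
apply: coord_vbasis_inj => i; rewrite /frame_vec !(linearD, linearZ) /=; ring.
Qed.

(** * The explicit bracket and its Kaehler-Weyl connection *)

Section Connection.
Variables x1 x2 y1 y2 : R.

(** The Weyl form, with values [x1], [y1], [0], [1 / 2] on [x], [J x], [y], [J y]. *)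
Definition kw_phi (u : V) : R := x1 * c0 u + y1 * c1 u + c3 u / 2.

(* [D_u x = (phi + mu J) x + (p + q J) y] and
   [D_u y = (phi + nu J) y - (p - q J) x], with [D_u] commuting with [J]. *)
Definition kw_conn (u v : V) : V :=
  let phi := kw_phi u in
  let mu := x1 * c1 u - s * y1 * c0 u - s * c2 u / 2 in
  let nu := x2 * c0 u + y2 * c1 u - s * c2 u / 2 in
  let p := - c1 u / 2 in
  let q := - s * c0 u / 2 in
  vec (phi * c0 v - s * mu * c1 v - p * c2 v - s * q * c3 v)
      (mu * c0 v + phi * c1 v + q * c2 v - p * c3 v)
      (p * c0 v - s * q * c1 v + phi * c2 v - s * nu * c3 v)
      (q * c0 v + p * c1 v + nu * c2 v + phi * c3 v).

Definition kw_bracket (u v : V) : V :=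
  vec 0 0
    (x1 * (c0 u * c2 v - c0 v * c2 u) - s * x2 * (c0 u * c3 v - c0 v * c3 u)
     + y1 * (c1 u * c2 v - c1 v * c2 u) - s * y2 * (c1 u * c3 v - c1 v * c3 u)
     + (c0 u * c1 v - c0 v * c1 u))
    (x1 * (c0 u * c3 v - c0 v * c3 u) + x2 * (c0 u * c2 v - c0 v * c2 u)
     + y1 * (c1 u * c3 v - c1 v * c3 u) + y2 * (c1 u * c2 v - c1 v * c2 u)).

Lemma kw_conn_torsion u v : kw_conn u v - kw_conn v u = kw_bracket u v.
Proof.
have [ss _ _ _] := comp.
rewrite -scaleN1r addrC frame_lin /kw_phi /kw_bracket.
move: (g x u) (g (J x) u) (g y u) (g (J y) u) => u0 u1 u2 u3.
move: (g x v) (g (J x) v) (g y v) (g (J y) v) => v0 v1 v2 v3.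
by congr frame_vec; field: ss.
Qed.

Lemma kw_conn_bilinear :
  exists D : {bilinear V -> V -> V}, forall u v, D u v = kw_conn u v.
Proof.
apply: bilinear_of => [w k u v | u k v w]; rewrite /= frame_lin /kw_conn /kw_phi
  !linearPr /=; congr frame_vec; ring.
Qed.

Lemma kw_bracket_bilinear :
  exists br : {bilinear V -> V -> V}, forall u v, br u v = kw_bracket u v.
Proof.
apply: bilinear_of => [w k u v | u k v w]; rewrite /= frame_lin /kw_bracket
  !linearPr /=; congr frame_vec; ring.
Qed.

Lemma frame_vec0 : vec 0 0 0 0 = 0.
Proof. by rewrite /frame_vec !scale0r !addr0. Qed.

Lemma frame_add a b c d a' b' c' d' :
  vec a b c d + vec a' b' c' d' = vec (a + a') (b + b') (c + c') (d + d').
Proof. by rewrite -[vec a b c d]scale1r frame_lin !mul1r. Qed.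

(** Jacobi reflects that [x] and [J x] act on the abelian ideal by commuting endomorphisms, while
    [[x, J x] = y] acts trivially on it. It is checked as a polynomial identity in coordinates. *)
Lemma kw_bracket_lie (br : {bilinear V -> V -> V}) :
  (forall u v, br u v = kw_bracket u v) -> lie_bracket br.
Proof.
move=> brE; split=> [u | u v w]; rewrite !brE.
  by rewrite -frame_vec0; congr frame_vec; ring.
have [ss _ _ _] := comp.
rewrite /kw_bracket !frame_coordE !frame_add -[RHS]frame_vec0.
move: (g x u) (g (J x) u) (g y u) (g (J y) u) => u0 u1 u2 u3.
move: (g x v) (g (J x) v) (g y v) (g (J y) v) => v0 v1 v2 v3.
move: (g x w) (g (J x) w) (g y w) (g (J y) w) => w0 w1 w2 w3.
congr frame_vec; ring: ss.
Qed.

Lemma frame_coordJ u :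
  (c0 (J u) = - s * (c1 u)) * (c1 (J u) = c0 u) *
  (c2 (J u) = - s * (c3 u)) * (c3 (J u) = c2 u).
Proof.
have [ss _ _ gJ] := comp.
have E w : g w (J u) = - g (J w) u by rewrite (compatible_skew comp) opprK.
by rewrite !gJ !E; do !split; ring: ss.
Qed.

(** One identity for both Nijenhuis conditions: [s = 1] gives the complex one, [s = -1] the
    para-complex one. It holds since the actions on the ideal commute with [J]. *)
Lemma kw_bracket_integrable (br : {bilinear V -> V -> V}) :
  (forall u v, br u v = kw_bracket u v) ->
  forall u v, br u v
    + s *: (J (br (J u) v) + J (br u (J v)) - br (J u) (J v)) = 0.
Proof.
move=> brE u v; have [ss _ _ _] := comp; rewrite !brE /kw_bracket !frame_coordJ.
rewrite !frame_J -scaleN1r frame_add addrC [X in s *: X]addrC frame_lin frame_lin.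
rewrite -[RHS]frame_vec0.
move: (g x u) (g (J x) u) (g y u) (g (J y) u) => u0 u1 u2 u3.
move: (g x v) (g (J x) v) (g y v) (g (J y) v) => v0 v1 v2 v3.
congr frame_vec; ring: ss.
Qed.

Lemma frame_dot a b c d v :
  g (vec a b c d) v = a * c0 v + s * b * c1 v + c * c2 v + s * d * c3 v.
Proof.
have [ss _ _ _] := comp.
rewrite /frame_vec !linearDl !linearZl_LR; ring: ss.
Qed.

(** Each [D u] is [kw_phi u] times the identity plus a [g]-skew endomorphism, and both commute with
    [J]. *)
Lemma kw_conn_kahler_weyl (br D : {bilinear V -> V -> V}) :
  (forall u v, br u v = kw_bracket u v) -> (forall u v, D u v = kw_conn u v) ->
  kahler_weyl br g J D.
Proof.
move=> brE DE; have [ss gC _ _] := comp; split.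
- by move=> u v; rewrite brE !DE kw_conn_torsion.
- have phi_lin : scalar kw_phi.
    by move=> k u v; rewrite /kw_phi !(linearDr, linearZr_LR); ring.
  pose m := GRing.isLinear.Build R V R *%R kw_phi phi_lin.
  exists (HB.pack kw_phi m : {scalar V}) => z u v.
  rewrite /cov_deriv_metric !DE (gC u) /kw_conn !frame_dot /=.
  have -> : g u v = c0 u * c0 v + s * c1 u * c1 v + c2 u * c2 v + s * c3 u * c3 v.
    by rewrite {1}(frame_expand dimV comp xy u) frame_dot.
  rewrite /kw_phi.
  move: (g x z) (g (J x) z) (g y z) (g (J y) z) => z0 z1 z2 z3.
  move: (g x u) (g (J x) u) (g y u) (g (J y) u) => u0 u1 u2 u3.
  move: (g x v) (g (J x) v) (g y v) (g (J y) v) => v0 v1 v2 v3.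
  by field: ss.
- move=> u v; apply/eqP; rewrite subr_eq0; apply/eqP.
  rewrite !DE /kw_conn !frame_coordJ frame_J; congr frame_vec; ring: ss.
Qed.

(** The skew part is traceless, so only the scalar part contributes. *)
Lemma kw_conn_trace (D : {bilinear V -> V -> V}) :
  (forall u v, D u v = kw_conn u v) -> forall u, trace (D u) = 4 * kw_phi u.
Proof.
move=> DE u; have [ss _ _ _] := comp.
have [tx tJx ty tJy] := adapted_table comp xy.
pose b (i : 'I_4) := [:: x; J x; y; J y]`_i.
pose c (i : 'I_4) : {scalar V} := g [:: x; s *: J x; y; s *: J y]`_i.
rewrite (@trace_dual_basis _ _ _ b c); last first.
  move=> v; rewrite {1}(frame_expand dimV comp xy v) /frame_vec.
  by rewrite !big_ord_recl big_ord0 /b /c /= !linearZl_LR addr0 !addrA.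
rewrite !big_ord_recl big_ord0 /b /c /= !DE /kw_conn !linearZl_LR.
by rewrite !frame_coordE !(tx, tJx, ty, tJy); field: ss.
Qed.

(** Brackets lie in the span of [y] and [J y], where [kw_phi] sees only the [J y] coordinate, with
    weight one half. Hence [alt_ricci] is that coordinate of the bracket, whose components are the
    four parameters. *)
Lemma realization (br D : {bilinear V -> V -> V}) (Xi : {biscalar V}) :
  alternating Xi -> Xi x (J x) = 0 -> Xi y (J y) = 0 ->
  [/\ Xi x (J y) = x1, Xi x y = x2, Xi (J x) (J y) = y1 & Xi (J x) y = y2] ->
  (forall u v, br u v = kw_bracket u v) -> (forall u v, D u v = kw_conn u v) ->
  forall u v, alt_ricci br D u v = Xi u v.
Proof.
move=> alt X0 Y0 [E1 E2 E3 E4] brE DE u v.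
rewrite alt_ricci_trace; last 2 first.
- exact: kw_bracket_lie.
- by case: (kw_conn_kahler_weyl brE DE).
rewrite (kw_conn_trace DE) brE /kw_phi !frame_coordE.
have XC := alternating_skew alt.
rewrite [in RHS](frame_expand dimV comp xy u).
rewrite [in RHS](frame_expand dimV comp xy v) /frame_vec.
rewrite !(linearDl, linearDr, linearZl_LR, linearZr_LR) /=.
rewrite (XC (J x) x) (XC y x) (XC y (J x)) (XC (J y) x) (XC (J y) (J x)).
by rewrite (XC (J y) y) !alt X0 Y0 E1 E2 E3 E4; field.
Qed.
End Connection.

Lemma realizable (Xi : {biscalar V}) :
  alternating Xi -> Xi x (J x) = 0 -> Xi y (J y) = 0 ->
  exists br : {bilinear V -> V -> V},
    [/\ lie_bracket br,
        forall u v, br u v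
          + s *: (J (br (J u) v) + J (br u (J v)) - br (J u) (J v)) = 0
      & exists2 D : {bilinear V -> V -> V},
          associated_kahler_weyl br g J D
        & forall u v, alt_ricci br D u v = Xi u v].
Proof.
move=> alt X0 Y0.
pose x1 := Xi x (J y); pose x2 := Xi x y.
pose y1 := Xi (J x) (J y); pose y2 := Xi (J x) y.
have [br brE] := kw_bracket_bilinear x1 x2 y1 y2.
have [D DE] := kw_conn_bilinear x1 x2 y1 y2.
have kw := kw_conn_kahler_weyl brE DE.
exists br; split; [exact: kw_bracket_lie brE | exact: kw_bracket_integrable brE |].
exists D; last exact: realization brE DE.
by split=> // D' kw'; apply: kahler_weyl_unique kw kw'.
Qed.

End Realization.

(** * Assembly of the two cases *)

Lemma compatible_realizable (R : realType) (V : vectType R) (s : R)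
    (g : {biscalar V}) (J : 'End(V)) (Xi : {biscalar V}) :
  \dim {:V} = 4%N -> compatible s g J -> (exists x y, adapted g J x y) ->
  Lambda2_sum s g J Xi ->
  exists br : {bilinear V -> V -> V},
    [/\ lie_bracket br,
        forall u v, br u v
          + s *: (J (br (J u) v) + J (br u (J v)) - br (J u) (J v)) = 0
      & exists2 D : {bilinear V -> V -> V},
          associated_kahler_weyl br g J D
        & forall u v, alt_ricci br D u v = Xi u v].
Proof.
move=> dimV comp [x0 [y0 xy0]] [theta [eta [th [etaA etaJ] XiE]]].
have [x [y [xy tx ty]]] := adapted_isotropic dimV comp xy0 th.
have [thA _ _] := th; have [ss _ JJ _] := comp.
(* The opposite [J]-type of [eta] makes it vanish here in every frame, so only [theta] constrains
   the choice of frame. *)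
have eta0 u : eta u (J u) = 0.
  have := etaJ u (J u); rewrite JJ linearZr_LR (alternating_skew etaA (J u)) => h.
  have {}h : s * (s * eta u (J u)) = - (s * (s * eta u (J u))).
    by rewrite -[in RHS]mulrN -[in RHS]mulNr -h; ring.
  by move: h; rewrite mulrA ss mul1r => h; lra.
apply: (realizable dimV comp xy).
- by move=> u; rewrite XiE thA etaA addr0.
- by rewrite XiE tx eta0 addr0.
- by rewrite XiE ty eta0 addr0.
Qed.

Theorem theorem1p3 (R : realType) :
  (forall (V : vectType R) (g : {biscalar V}) (J : 'End(V)),
     hermitian_space g J ->
     forall Xi : {biscalar V},
       Lambda2_sum 1 g J Xi -> hermitian_realizable g J Xi) /\
  (forall (V : vectType R) (g : {biscalar V}) (J : 'End(V)),
     para_hermitian_space g J ->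
     forall Xi : {biscalar V},
       Lambda2_sum (-1) g J Xi -> para_hermitian_realizable g J Xi).
Proof.
split=> V g J H Xi XiL.
  have [comp ex] := hermitian_adapted H; case: H => dimV _ _ _.
  have [br [lie int kw]] := compatible_realizable dimV comp ex XiL.
  exists br; split=> // u v.
  by rewrite -[RHS](int u v) scale1r !addrA.
have [comp ex] := para_hermitian_adapted H; case: H => dimV _ _ _ _.
have [br [lie int kw]] := compatible_realizable dimV comp ex XiL.
exists br; split=> // u v.
by rewrite -[RHS](int u v) scaleN1r !opprD opprK !addrA.
Qed.
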